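(* Let $P_{5,2}$ denote the Petersen graph. For any triangle-free cubic graph $G$ and any $\lambda\in(0,1]$, \[ \frac{1}{|V(G)|}\log P_G(\lambda) \ge \frac{1}{10}\log P_{P_{5,2}}(\lambda), \] and in particular \[ \frac{1}{|V(G)|}\log|\mathcal I(G)| \ge \frac{1}{10}\log|\mathcal I(P_{5,2})|, \] with equality (in either inequality) if and only if $G$ is a disjoint union of copies of $P_{5,2}$.
   Context: All graphs are finite, simple and non-empty. A graph is cubic if it is $3$-regular. $\mathcal I(G)$ is the set of all independent sets of $G$ (including the empty set), and $P_G(\lambda)=\sum_{I\in\mathcal I(G)}\lambda^{|I|}$ is the independence polynomial of $G$. The Petersen graph $P_{5,2}$ is the usual $3$-regular, vertex-transitive graph on $10$ vertices of girth $5$. ''$G$ is a (disjoint) union of copies of $H$'' means that every connected component of $G$ is isomorphic to $H$. *)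

(* Defs.v *)
From HB Require Import structures.
From mathcomp Require Import all_boot all_order all_algebra.

Set Implicit Arguments.
Unset Strict Implicit.
Unset Printing Implicit Defensive.

Import GRing.Theory.

Record sgraph := SGraph {
  vertex :> finType;
  adj : rel vertex;
  adj_sym : symmetric adj;
  adj_irrefl : irreflexive adj }.

Definition cubic (G : sgraph) : Prop :=
  forall x : G, #|[set y | adj x y]| = 3.

Definition triangle_free (G : sgraph) : Prop :=
  forall x y z : G, adj x y -> adj y z -> adj x z -> False.

Definition independent (G : sgraph) (S : {set G}) : bool :=
  [forall x in S, forall y in S, ~~ adj x y].

Definition indep_sets (G : sgraph) : {set {set G}} :=
  [set S | independent S].

Definition indep_poly (R : nzRingType) (G : sgraph) : {poly R} :=
  (\sum_(S in indep_sets G) 'X^#|S|)%R.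

Definition isomorphic (G H : sgraph) : Prop :=
  exists2 f : G -> H, bijective f & forall x y, adj (f x) (f y) = adj x y.

Section Induced.
Variables (G : sgraph) (S : {set G}).

Definition induced_adj : rel {x | x \in S} :=
  fun x y => adj (val x) (val y).

Fact induced_adj_sym : symmetric induced_adj.
Proof. by move=> x y; exact: adj_sym. Qed.

Fact induced_adj_irrefl : irreflexive induced_adj.
Proof. by move=> x; exact: adj_irrefl. Qed.

Definition induced : sgraph := SGraph induced_adj_sym induced_adj_irrefl.

End Induced.

Definition components (G : sgraph) : {set {set G}} :=
  [set [set y | connect (@adj G) x y] | x : G].

Definition union_of_copies (H G : sgraph) : Prop :=
  forall C : {set G}, C \in components G -> isomorphic (induced C) H.

(* The generalized Petersen graph with parameters (5, 2): (false, i) is the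
   i-th vertex of the outer pentagon, (true, i) the i-th vertex of the inner
   pentagram, where consecutive vertices differ by 2 modulo 5. *)
Definition petersen_adj : rel (bool * 'I_5) := fun u v =>
  if u.1 == v.1 then
    let k := if u.1 then 2 else 1 in
    (v.2 == u.2 + k %[mod 5]) || (u.2 == v.2 + k %[mod 5])
  else u.2 == v.2.

Fact petersen_adj_sym : symmetric petersen_adj.
Proof.
move=> [a i] [b j]; rewrite /petersen_adj /= [b == a]eq_sym [j == i]eq_sym.
by case: eqP => // ->; rewrite orbC.
Qed.

Fact petersen_adj_irrefl : irreflexive petersen_adj.
Proof. by case=> [[] [[|[|[|[|[|i]]]]] lti]]. Qed.

Definition petersen : sgraph := SGraph petersen_adj_sym petersen_adj_irrefl.

(* Main.v *)
From Stdlib Require Import ZArith.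
Require Import Defs.
From HB Require Import structures.
From mathcomp Require Import all_boot all_order all_algebra.
From mathcomp Require Import ssrZ zify ring lra.

(** The occupancy method of Perarnau and Perkins. Write [x] for the fugacity and
    [n] for the number of vertices. It suffices that the logarithmic derivative
    of [P_G] is at least [n/10] times that of the Petersen graph on [(0, 1]],
    strictly on [(0, 1)] unless [G] is a union of Petersen graphs; then
    [10 ln P_G - n ln P_Petersen], which vanishes at [0], is nonnegative.

    Up to normalization the difference of the two sides is a sum over vertices
    [v] of [\sum_I x^|I| phi v I], where [phi] is corrected by multiples of
    [[v \in I] #{u ~ v : d(u) = k} - k [d(v) = k]], with [d(u)] the number of
    neighbours of [u] in [I]; double counting edges shows that these corrections
    sum to [0] over [v]. For suitable multipliers each vertex contributes a
    nonnegative amount: fix the part of [I] outside the ball of radius 2 around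
    [v] and sum over the rest. The result is a polynomial in [x] determined by
    the graph induced on the second neighbours of [v] that are not blocked from
    outside. There are finitely many possibilities, and each polynomial has
    nonnegative partial sums of coefficients. It vanishes only if the second
    neighbours form the hexagon of the Petersen graph, in which case the
    component of [v] is a Petersen graph. *)

Set Implicit Arguments.
Unset Strict Implicit.
Unset Printing Implicit Defensive.

Import Order.TTheory GRing.Theory Num.Theory.

(** * Configurations of second neighbours *)

Fixpoint addz (p q : seq Z) : seq Z :=
  match p, q with
  | [::], _ => q
  | _, [::] => p
  | a :: p', b :: q' => Z.add a b :: addz p' q'
  end.

Definition shiftz k (p : seq Z) : seq Z := nseq k Z0 ++ p.

Fixpoint psums_ge0 (s : Z) (p : seq Z) : bool :=
  if p is a :: p' then let t := Z.add s a in Z.leb Z0 t && psums_ge0 t p'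
  else true.

Definition zerop (p : seq Z) : bool := all (Z.eqb Z0) p.

(* With [u1], [u2], [u3] the neighbours of [v], a configuration lists second
   neighbours of [v]: for each one the mask of the [u_i] adjacent to it, and its
   adjacencies to the later entries of the list. *)
Definition mask3 : Type := (bool * bool * bool)%type.
Definition cell : Type := (mask3 * bitseq)%type.

(* [c] is the strictly upper triangular part of an adjacency matrix. *)
Fixpoint indep_masks (c : seq bitseq) : seq bitseq :=
  if c is a :: c' then
    let r := indep_masks c' in
    map (cons false) r ++ map (cons true) [seq b <- r | ~~ has id (mask a b)]
  else [:: [::]].

Delimit Scope Z_scope with Zbin.

(* Coefficients of the sum of [x^|I| phi v I] over the possible traces of [I] on
   [{v, u1, u2, u3}] when the [u_i] have [i], [j], [k] neighbours in the rest of
   [I]; see [sum_star]. *)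
Definition star_weight (i j k : nat) : seq Z :=
  match ((i == 0) + (j == 0) + (k == 0))%N,
        ((i == 1) + (j == 1) + (k == 1))%N with
  | 0, 0 => [:: 0; 0; 9; 24; 12; 9]%Zbin
  | 0, 1 => [:: 0; 0; 6; 15; 11; 6]%Zbin
  | 0, 2 => [:: 0; 0; 3; 6; 10; 3]%Zbin
  | 0, _ => [:: 0; 0; 0; -3; 9]%Zbin
  | 1, 0 => [:: 0; 0; 6; 13; 0; 3]%Zbin
  | 1, 1 => [:: 0; 0; 3; 4; -1]%Zbin
  | 1, _ => [:: 0; 0; 0; -5; -2; -3]%Zbin
  | 2, 0 => [:: 0; 0; 3; 5; 2; 2]%Zbin
  | 2, _ => [:: 0; 0; 0; -4; 1; -1]%Zbin
  | _, _ => [:: 0; 0; 0; 0; 15; 9; 18; -6]%Zbin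
  end.

Definition branch_count (f : mask3 -> bool) (c : seq cell) (b : bitseq) : nat :=
  count f (mask b (map fst c)).

Definition m1 (m : mask3) := m.1.1.
Definition m2 (m : mask3) := m.1.2.
Definition m3 (m : mask3) := m.2.

Definition config_weight (c : seq cell) : seq Z :=
  foldr addz [::]
    [seq shiftz (count id b) (star_weight (branch_count m1 c b)
                                (branch_count m2 c b) (branch_count m3 c b))
    | b <- indep_masks (map snd c)].

Definition mask_code (m : mask3) : nat := (m1 m + (m2 m).*2 + (m3 m).*2.*2)%N.

(** Second neighbours with a common [u_i] cannot be adjacent: they would form a triangle with it. *)
Definition disjoint_masks (m m' : mask3) : bool :=
  ~~ [|| m1 m && m1 m', m2 m && m2 m' | m3 m && m3 m'].

Fixpoint new_rows (m : mask3) (c : seq cell) : seq bitseq :=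
  if c is e :: c' then
    let r := new_rows m c' in
    map (cons false) r ++
      (if disjoint_masks m e.1 then map (cons true) r else [::])
  else [:: [::]].

(** A second neighbour sees some [u_i], and each [u_i], being adjacent to [v], has only two other
    neighbours. *)
Definition ok_mask (m : mask3) (c : seq cell) : bool :=
  [&& 0 < mask_code m,
      (if c is e :: _ then mask_code e.1 <= mask_code m else true),
      m1 m + count m1 (map fst c) <= 2,
      m2 m + count m2 (map fst c) <= 2 &
      m3 m + count m3 (map fst c) <= 2]%N.

(** Excludes triangles consisting of three second neighbours. *)
Fixpoint ok_row (a : bitseq) (c : seq cell) : bool :=
  match a, c with
  | b :: a', e :: c' => ~~ (b && has id (mask e.2 a')) && ok_row a' c'
  | _, _ => true
  end.

Fixpoint valid_config (c : seq cell) : bool :=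
  if c is e :: c' then
    [&& ok_mask e.1 c', e.2 \in new_rows e.1 c', ok_row e.2 c'
      & valid_config c']
  else true.

Definition mA : mask3 := (true, false, false).
Definition mB : mask3 := (false, true, false).
Definition mC : mask3 := (false, false, true).

(* The two neighbours of the first vertex determine the hexagon in which the
   vertices sharing a mask are antipodal; the other value of [c] would give two
   triangles. *)
Definition hexagon (a b : bool) : seq cell :=
  let c := a (+) b in
  [:: (mC, [:: false; a; ~~ a; b; ~~ b]);
      (mC, [:: ~~ a; a; ~~ b; b]);
      (mB, [:: false; c; ~~ c]);
      (mB, [:: ~~ c; c]);
      (mA, [:: false]);
      (mA, [::])].

Definition hexagons : seq (seq cell) :=
  [:: hexagon false false; hexagon false true; hexagon true false;
      hexagon true true].

(** Nonnegative partial sums give a nonnegative value on [[0, 1]], and a positive one on [(0, 1)]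
    unless all coefficients vanish. Equality is thus a matter of the zero polynomial, which only the
    hexagons may produce. *)
Definition weight_ok (c : seq cell) : bool :=
  let w := config_weight c in
  psums_ge0 Z0 w && (if zerop w then c \in hexagons else true).

Definition bools := [:: true; false].

Definition all_masks : seq mask3 :=
  flatten [seq flatten [seq [seq (a, b, c) | c <- bools] | b <- bools]
          | a <- bools].

(* Explores all valid extensions of [c] by at most [n] vertices; masks are
   sorted only to keep their number low. *)
Fixpoint check_from (n : nat) (c : seq cell) : bool :=
  weight_ok c && (if n is n'.+1 then
    all (fun m : mask3 => if ok_mask m c then
      all (fun a => if ok_row a c then check_from n' ((m, a) :: c) else true)
        (new_rows m c) else true) all_masks else true).

Local Open Scope ring_scope.

(** * Positivity of integer polynomials on the unit interval *)

Section IntegerPolynomials.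
Variable R : realFieldType.
Implicit Types (p q : seq Z) (x : R).

Definition evalz x p : R := foldr (fun a r => (int_of_Z a)%:~R + x * r) 0 p.

Lemma evalz_add x p q : evalz x (addz p q) = evalz x p + evalz x q.
Proof.
elim: p q => [|a p IH] [|b q] /=; rewrite ?add0r ?addr0 // IH.
by rewrite (_ : Z.add a b = a + b) // raddfD rmorphD /=; ring.
Qed.

Lemma evalz_shift x k p : evalz x (shiftz k p) = x ^+ k * evalz x p.
Proof. by elim: k => [|k IH] /=; rewrite ?mul1r // IH exprS add0r mulrA. Qed.

Lemma int_of_Z_ge0 (z : Z) : Z.leb Z0 z -> 0 <= (int_of_Z z)%:~R :> R.
Proof. by case: z. Qed.

(* Abel summation: with partial sums [s_i], the value is
   [\sum_i s_i (x^i - x^(i+1))] plus a nonnegative last term. *)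
Lemma psums_ge0P x s p : 0 <= x <= 1 -> Z.leb Z0 s -> psums_ge0 s p ->
  0 <= (int_of_Z s)%:~R + evalz x p.
Proof.
move=> /andP[x0 x1]; elim: p s => [|a p IH] s s0 /=.
  by rewrite addr0 int_of_Z_ge0.
move=> /andP[t0 /(IH _ t0)]; have := int_of_Z_ge0 t0.
rewrite (_ : Z.add s a = s + a) // raddfD rmorphD /= => h1 h2.
nra.
Qed.

(** Leading zeros only contribute factors [x]. The first nonzero coefficient is itself a partial
    sum, hence positive. *)
Lemma psums_gt0 x p : 0 < x < 1 -> psums_ge0 Z0 p -> ~~ zerop p ->
  0 < evalz x p.
Proof.
move=> /andP[x0 x1]; elim: p => [//|a p IH] /= /andP[a0 pa].
case: (boolP (Z.eqb Z0 a)) => [a_0 /= pn0|an0 _].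
  have /Z.eqb_eq ea := a_0.
  move: pa pn0; rewrite -ea => pa pn0.
  by rewrite add0r mulr_gt0 ?IH.
have x01 : 0 <= x <= 1 by rewrite !ltW.
have h := psums_ge0P x01 a0 pa.
have : 0 < (int_of_Z a)%:~R :> R.
  by case: a an0 a0 {pa h} => //= a _ _; rewrite /= -[_%:~R]/(_%:R) ltr0n; lia.
(* The value is [(1 - x) a + x (a + evalz x p)]: the first summand is positive, the second
   nonnegative by [h]. *)
nra.
Qed.

Lemma psums_ge0_eval x p : 0 <= x <= 1 -> psums_ge0 Z0 p -> 0 <= evalz x p.
Proof. by move=> hx /(psums_ge0P hx) => /(_ isT); rewrite add0r. Qed.

End IntegerPolynomials.

(** * The exhaustive check of configurations *)

Lemma check_from_nil : check_from 6 [::].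
Proof. by vm_compute. Qed.

(** The search prepends vertices, so the entry of [d] next to [c] is explored first; the induction
    on [n] moves this last entry of [d] into [c]. *)
Lemma check_from_sound n c d :
  check_from n c -> valid_config (d ++ c) -> (size d <= n)%N ->
  weight_ok (d ++ c).
Proof.
elim: n c d => [|n IH] c d.
  by case: d => //= + _ _; case/andP.
case/lastP: d => [|d e]; first by case/andP.
rewrite size_rcons ltnS cat_rcons => /andP[_ sc] vdc sd.
move/allP: sc => sc.
have /and4P[om nr ok _] : valid_config (e :: c).
  by elim: d vdc {sd} => //= f d IHd /and4P[_ _ _ /IHd].
apply: IH => //; have em : e.1 \in all_masks by case: (e.1) => [[[] []] []].
have := sc _ em; rewrite om => /allP/(_ _ nr).
by rewrite ok -surjective_pairing.
Qed.

(** Every mask is nonzero and each [u_i] occurs in at most two masks, which leaves room for 2 + 2 +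
    2 entries. Hence a search of depth 6 is exhaustive. *)
Lemma valid_config_size c : valid_config c -> (size c <= 6)%N.
Proof.
move=> vc; have cover : [&& count m1 (map fst c) <= 2,
    count m2 (map fst c) <= 2 & count m3 (map fst c) <= 2]%N.
  by case: c vc => //= e c /and4P[/and5P[_ _ -> -> ->]].
have {cover} le6 : (count m1 (map fst c) + count m2 (map fst c)
    + count m3 (map fst c) <= 6)%N.
  by case/and3P: cover; lia.
apply: leq_trans le6.
elim: c vc => //= e c IH /and4P[/andP[e0 _] _ _ /IH].
move: e0; rewrite /mask_code.
by case: (m1 _) (m2 _) (m3 _) => [] [] [] //=; lia.
Qed.

Lemma valid_config_ok c : valid_config c -> weight_ok c.
Proof.
move=> vc; rewrite -[c]cats0 (check_from_sound check_from_nil) ?cats0 //.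
exact: valid_config_size.
Qed.

(** * Sums over independent sets *)

Section SumSubsets.
Variables (T : finType) (V : nmodType).
Implicit Types (A B : {set T}) (F : {set T} -> V).

Lemma sum_subsets_split A B F : [disjoint A & B] ->
  \sum_(S : {set T} | S \subset A :|: B) F S =
  \sum_(S : {set T} | S \subset A) \sum_(S' : {set T} | S' \subset B)
    F (S :|: S').
Proof.
move=> dAB; rewrite pair_big /=.
rewrite (reindex_onto (fun p => p.1 :|: p.2)
  (fun S => (S :&: A, S :&: B))) /=; last first.
  by move=> S sS; rewrite -setIUr; apply/setIidPl.
apply: eq_bigl => -[S S'] /=; apply/andP/andP => [[sSS /eqP[<- <-]]|[sS sS']].
  by rewrite !subsetIr.
split; first exact: setUSS.
have h1 : S' :&: A = set0.
  apply: disjoint_setI0; rewrite disjoint_sym; exact: disjointWr sS' dAB.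
have h2 : S :&: B = set0 by apply: disjoint_setI0; exact: disjointWl sS dAB.
by rewrite !setIUl h1 h2 setU0 set0U (setIidPl sS) (setIidPl sS').
Qed.

Lemma sum_subsets_setU1 x B F : x \notin B ->
  \sum_(S : {set T} | S \subset x |: B) F S =
  \sum_(S : {set T} | S \subset B) (F S + F (x |: S)).
Proof.
move=> xB; rewrite sum_subsets_split ?disjoints1 // exchange_big.
apply: eq_bigr => S _ /=.
rewrite (bigD1 set0) ?sub0set //= set0U; congr (_ + _).
rewrite (bigD1 [set x]) /= ?subxx; last first.
  by apply/eqP => /setP/(_ x); rewrite !inE eqxx.
by rewrite big1 ?addr0 // => S' /andP[/andP[]]; rewrite subset1 => /orP[]->.
Qed.

End SumSubsets.

Section Rows.
Variable G : sgraph.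
Implicit Types (s : seq G) (x y z : G) (S L : {set G}).

Definition nbrs x : {set G} := [set y | adj x y].

Fixpoint rows s : seq bitseq :=
  if s is x :: r then [seq adj x y | y <- r] :: rows r else [::].

Lemma has_row x s (b : bitseq) :
  has id (mask [seq adj x y | y <- s] b) = has (adj x) (mask b s).
Proof.
by elim: s b => [|y s IH] [|[] b] //=; rewrite ?mask0 //; case: (adj x y) => /=.
Qed.

Lemma size_indep_masks s b : b \in indep_masks (rows s) -> size b = size s.
Proof.
elim: s b => [|x s IH] b /=; first by rewrite inE => /eqP->.
by rewrite mem_cat => /orP[] /mapP[c]; rewrite ?mem_filter => + ->;
  [move=> /IH/= ->|move=> /andP[_ /IH/= ->]].
Qed.

Lemma independentP S :
  reflect {in S &, forall y z, ~~ adj y z} (independent S).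
Proof.
apply: (iffP forall_inP) => [h y z yS zS|h y yS].
  by have /forall_inP := h y yS; apply.
by apply/forall_inP => z zS; exact: h.
Qed.

Lemma independentU S L : independent (S :|: L) =
  [&& independent S, independent L & [forall y in S, nbrs y :&: L == set0]].
Proof.
apply/independentP/and3P
  => [h|[/independentP hS /independentP hL /forall_inP h]].
  split; [apply/independentP => y z yS zS|apply/independentP => y z yS zS|].
  - by apply: h; rewrite inE ?yS ?zS.
  - by apply: h; rewrite inE ?yS ?zS orbT.
  - apply/forall_inP => y yS; apply/eqP/setP => z; rewrite !inE.
    apply/negP => /andP[yz zL]; have := h y z.
    by rewrite !inE yS zL orbT yz => /(_ isT isT).
have hSL y z : y \in S -> z \in L -> ~~ adj y z.
  move=> yS zL; have /eqP/setP/(_ z) := h y yS.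
  by rewrite !inE zL andbT => ->.
move=> y z; rewrite !inE => /orP[yS|yL] /orP[zS|zL].
- exact: hS.
- exact: hSL.
- by rewrite adj_sym hSL.
- exact: hL.
Qed.

Lemma independentU1 x S :
  independent (x |: S) = independent S && [forall y in S, ~~ adj x y].
Proof.
have -> : independent (x |: S) = independent S && (nbrs x :&: S == set0).
  rewrite independentU (_ : independent [set x]) /=; last first.
    by apply/independentP => y z /set1P-> /set1P->; rewrite adj_irrefl.
  congr (_ && _); apply/forall_inP/idP => [|h y /set1P->] //.
  by apply; rewrite inE.
congr (_ && _); apply/eqP/forall_inP => [/setP h y yS|h].
  by have := h y; rewrite !inE yS andbT => ->.
by apply/setP => y; rewrite !inE; apply/negP => /andP[xy /h]; rewrite xy.
Qed.

(** The link between abstract sums over sets and the computable enumeration. The induction follows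
    [indep_masks]: the head is either left out, or added to an independent set that avoids its
    neighbours. *)
Lemma sum_indep_seq (V : nmodType) (F : {set G} -> V) s : uniq s ->
  \sum_(S : {set G} | (S \subset [set x in s]) && independent S) F S =
  \sum_(b <- indep_masks (rows s)) F [set x in mask b s].
Proof.
elim: s F => [|x s IH] F /=.
  move=> _; rewrite big_seq1 (bigD1 set0) /=; last first.
    by rewrite sub0set; apply/forall_inP => y; rewrite inE.
  rewrite big1 ?addr0; first by congr F; apply/setP => y; rewrite !inE.
  move=> S /andP[/andP[+ _] S0]; rewrite (_ : [set y in [::]] = set0).
    by rewrite subset0 (negPf S0).
  by apply/setP => y; rewrite !inE.
move=> /andP[xs us]; rewrite set_cons big_mkcondr sum_subsets_setU1 ?inE //.
rewrite big_split /= big_cat /= !big_map big_filter; congr (_ + _).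
  by rewrite -big_mkcondr IH.
transitivity (\sum_(S : {set G} | (S \subset [set y in s]) && independent S)
   if [forall y in S, ~~ adj x y] then F (x |: S) else 0).
  rewrite [RHS]big_mkcondr; apply: eq_bigr => S _.
  by rewrite independentU1; case: (independent S).
rewrite IH // -big_mkcond /=; apply: congr_big => // [b|b _].
  rewrite has_row; apply/forall_inP/idP => [h|/hasPn h y].
    by apply/hasPn => y yb; apply: h; rewrite inE.
  by rewrite inE; exact: h.
by rewrite set_cons.
Qed.

End Rows.

Section Cfg.
Variable G : sgraph.
Implicit Types (s : seq G) (x y z : G) (S L : {set G}).

Variables u1 u2 u3 : G.

Definition branch_mask x : mask3 := (adj u1 x, adj u2 x, adj u3 x).

Fixpoint config s : seq cell :=
  if s is x :: r then (branch_mask x, [seq adj x y | y <- r]) :: config r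
  else [::].

Lemma config_rows s : map snd (config s) = rows s.
Proof. by elim: s => //= x s ->. Qed.

Lemma config_masks s : map fst (config s) = map branch_mask s.
Proof. by elim: s => //= x s ->. Qed.

Definition on_branches S (f : nat -> nat -> nat -> seq Z) : seq Z :=
  f #|nbrs u1 :&: S| #|nbrs u2 :&: S| #|nbrs u3 :&: S|.

Lemma card_cover u (b : bitseq) s : uniq s ->
  #|nbrs u :&: [set x in mask b s]| = count (adj u) (mask b s).
Proof.
move=> us; rewrite -size_filter -(card_uniqP (filter_uniq _ (mask_uniq us b))).
by apply: eq_card => x; rewrite !inE mem_filter.
Qed.

Lemma config_weightE (R : realFieldType) (x : R) s : uniq s ->
  \sum_(S : {set G} | (S \subset [set y in s]) && independent S)
     x ^+ #|S| * evalz x (on_branches S star_weight) =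
  evalz x (config_weight (config s)).
Proof.
move=> us; rewrite sum_indep_seq // /config_weight config_rows.
(* One side of this trivial inclusion stays fixed during the induction; membership in the full list
   provides the length of each mask. *)
have : {subset indep_masks (rows s) <= indep_masks (rows s)} by [].
elim: {1 3 4}(indep_masks _) => [|b r IH] hr; first by rewrite big_nil.
rewrite big_cons /= evalz_add evalz_shift IH; last first.
  by move=> c cr; apply: hr; rewrite inE cr orbT.
congr (_ * _ + _).
  rewrite (_ : #|_| = size (mask b s)); last first.
    rewrite -(card_uniqP (mask_uniq us b)).
    by apply: eq_card => y; rewrite inE.
  rewrite size_mask //; apply/size_indep_masks/hr; exact: mem_head.
rewrite /on_branches /branch_count config_masks !card_cover //.
by rewrite -!map_mask !count_map.
Qed.

Hypothesis tf : triangle_free G.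
Variable v : G.
Hypothesis nbrs_v : nbrs v = [set u1; u2; u3].
Hypothesis cub : cubic G.

(** The conditions on rows come from triangle-freeness. The bound 2 on each branch comes from degree
    three, as [v] is already a neighbour of each [u_i]. *)
Lemma valid_config_of_graph s : uniq s -> v \notin s ->
  {in s, forall x, [|| adj u1 x, adj u2 x | adj u3 x]} ->
  sorted (fun x y =>
    (mask_code (branch_mask y) <= mask_code (branch_mask x))%N) s ->
  valid_config (config s).
Proof.
have au : [/\ adj u1 v, adj u2 v & adj u3 v].
  have h u : u \in nbrs v -> adj u v by rewrite inE adj_sym.
  by split; apply: h; rewrite nbrs_v !inE eqxx ?orbT.
elim: s => //= x s IH /andP[xs us].
rewrite inE negb_or => /andP[vx vs] dom srt.
apply/and4P; split; last first.
- by apply: IH => //; [move=> y ys; apply: dom; rewrite inE ys orbT|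
    exact: path_sorted srt].
- elim: s {IH us vs dom srt xs} => //= y s ->; rewrite andbT.
  apply/negP => /andP[xy]; rewrite has_row -filter_mask => /hasP[z].
  by rewrite mem_filter => /andP[xz _] yz; exact: tf xy yz xz.
- elim: s {IH us vs dom srt xs} => //= y s IH.
  rewrite mem_cat; case: (boolP (adj x y)) => xy; last first.
    by rewrite (map_f (cons false)).
  rewrite (_ : disjoint_masks _ _) ?(map_f (cons true)) ?orbT //.
  by apply/negP => /or3P[] /andP[ux uy]; exact: tf ux xy uy.
have cov2 u : adj u v -> ((adj u x : nat) + count (adj u) s <= 2)%N.
  move=> uv; have : (#|[set y in [:: v, x & s] | adj u y]| <= 3)%N.
    rewrite -(cub u); apply: subset_leq_card; apply/subsetP => y.
    by rewrite !inE => /andP[].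
  rewrite (_ : #|_| = count (adj u) [:: v, x & s]); first by rewrite /= uv.
  rewrite -size_filter -(card_uniqP (filter_uniq _ _)).
    by apply: eq_card => y; rewrite !inE mem_filter andbC.
  by rewrite /= inE negb_or vx vs xs.
case: au => u1v u2v u3v; rewrite /ok_mask config_masks !count_map.
apply/and5P; split; rewrite ?cov2 //.
  by move: (dom x); rewrite inE eqxx /mask_code /m1 /m2 /m3 /= => /(_ isT);
     case: (adj _ _) (adj _ _) (adj _ _) => [] [] [].
by case: s srt {IH xs us vs dom cov2} => //= y s /andP[].
Qed.

End Cfg.

(** * The contribution of a vertex *)

Section Dual.
Variables (R : realFieldType) (x : R).

Definition petP : R := 1 + 10 * x + 30 * x ^+ 2 + 30 * x ^+ 3 + 5 * x ^+ 4.
(* [x / 10] times the derivative of [petP]. *)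
Definition petN : R := x * (1 + 6 * x + 9 * x ^+ 2 + 2 * x ^+ 3).
(* The multipliers are a rounded dual solution of the linear program whose
   constraints say that every configuration has a nonnegative weight. *)
Definition dualA : R := 3 * x + 16 * x ^+ 2 + 16 * x ^+ 3 + 3 * x ^+ 4.
Definition dualB : R := 7 * x ^+ 2 + 15 * x ^+ 3.

Variable G : sgraph.
Implicit Types (s t : seq G) (u v w y z : G) (I S L : {set G}).

Definition occ_deg I u : nat := #|nbrs u :&: I|.
Definition nbrs_of_deg I v (k : nat) : nat :=
  #|[set u in nbrs v | occ_deg I u == k]|.

Definition phi v I : R :=
  (v \in I)%:R * (3 * petP - dualA * (nbrs_of_deg I v 2)%:R
                   - dualB * (nbrs_of_deg I v 3)%:R)
  + dualA * (2 * (occ_deg I v == 2))%:R + dualB * (3 * (occ_deg I v == 3))%:R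
  - 3 * petN.

(** Both sides count the adjacent pairs [v], [u] with [v] in [I] and exactly [k] neighbours of [u]
    in [I]. *)
Lemma sum_degs I k :
  \sum_v (v \in I)%:R * (nbrs_of_deg I v k)%:R =
  \sum_u (k * (occ_deg I u == k))%:R :> R.
Proof.
transitivity
  (\sum_v \sum_u ((v \in I) && adj v u && (occ_deg I u == k))%:R : R).
  apply: eq_bigr => v _; rewrite -natrM mulnbl /nbrs_of_deg -sum1_card.
  case: (v \in I).
    rewrite natr_sum big_mkcond; apply: eq_bigr => u _; rewrite !inE /=.
    by case: ifP.
  by rewrite big1.
rewrite exchange_big; apply: eq_bigr => u _ /=.
case: eqP => [eqk|_]; last by rewrite muln0 big1 // => v _; rewrite andbF.
rewrite muln1 -[in RHS]eqk /occ_deg -sum1_card natr_sum [RHS]big_mkcond /=.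
by apply: eq_bigr => v _; rewrite !inE andbT andbC adj_sym; case: (_ && _).
Qed.

(** The terms with [dualA] and [dualB] cancel by [sum_degs] for [k = 2] and [k = 3]. *)
Lemma sum_phi I :
  \sum_v phi v I = 3 * petP * #|I|%:R - 3 * petN * #|G|%:R.
Proof.
rewrite /phi sumrB !big_split /= sumr_const mulr_natr.
congr (_ - _); last by rewrite mulr_natr.
rewrite -!mulr_sumr -!sum_degs.
transitivity (\sum_v (v \in I)%:R * (3 * petP)).
  rewrite !mulr_sumr -!big_split; apply: eq_bigr => v _ /=; ring.
rewrite -mulr_suml mulrC -[RHS]mulr_natr -sum1_card natr_sum.
rewrite [in RHS]big_mkcond; congr (_ * _).
by apply: eq_bigr => v _; case: (v \in I).
Qed.

End Dual.

Section Inner.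
Variables (R : realFieldType) (x : R) (G : sgraph).
Hypothesis tf : triangle_free G.
Variables v u1 u2 u3 : G.
Hypothesis nbrs_v : nbrs v = [set u1; u2; u3].
Hypothesis u_uniq : uniq [:: u1; u2; u3].
Variable L : {set G}.
Hypothesis vL : v \notin L.
Hypothesis nvL : nbrs v :&: L = set0.
Hypothesis indL : independent L.
Hypothesis cub : cubic G.

Let adj_u u : u \in [:: u1; u2; u3] = adj v u.
Proof. by have /setP/(_ u) := nbrs_v; rewrite !inE -orbA. Qed.

Let star := [:: v; u1; u2; u3].

Let star_uniq : uniq star.
Proof. by rewrite cons_uniq u_uniq adj_u adj_irrefl. Qed.

Lemma star_adj : rows star =
  [:: [:: true; true; true]; [:: false; false]; [:: false]; [::]].
Proof.
have au u : u \in [:: u1; u2; u3] -> adj v u by rewrite adj_u.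
have nuu u u' : u \in [:: u1; u2; u3] -> u' \in [:: u1; u2; u3] ->
    adj u u' = false.
  by move=> /au vu /au vu'; apply/negP => uu'; exact: tf vu uu' vu'.
by rewrite /= !au ?nuu ?inE ?eqxx ?orbT.
Qed.

Lemma degU_seq t u : uniq t -> {subset t <= star} ->
  occ_deg ([set y in t] :|: L) u = (count (adj u) t + #|nbrs u :&: L|)%N.
Proof.
move=> ut ts; rewrite /occ_deg setIUr cardsU.
rewrite (_ : _ :&: _ :&: _ = set0); last first.
  apply/setP => y; rewrite !inE; apply/negP => /and3P[/andP[_ /ts]].
  rewrite inE adj_u => /orP[/eqP->|vy] _; first by rewrite (negPf vL).
  by move=> yL; have /setP/(_ y) := nvL; rewrite !inE vy yL.
rewrite cards0 subn0 -size_filter -(card_uniqP (filter_uniq _ ut)).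
by congr (_ + _)%N; apply: eq_card => y; rewrite !inE mem_filter.
Qed.

Lemma cover_le2 u : adj v u -> (#|nbrs u :&: L| <= 2)%N.
Proof.
move=> vu; rewrite -ltnS -[X in (_ < X)%N](cub u); apply: proper_card.
apply/properP; split; first by apply/subsetP => y; rewrite !inE => /andP[].
by exists v; rewrite !inE ?(negPf vL) ?andbF // adj_sym.
Qed.

(** [phi] sees [L] only through the three numbers [c u1], [c u2], [c u3], which makes a finite case
    analysis possible. *)
Lemma phi_seq t (c := fun u => #|nbrs u :&: L|)
    (d := fun u => (count (adj u) t + c u)%N)
    (n := fun k : nat => ((d u1 == k) + (d u2 == k) + (d u3 == k))%N) :
  uniq t -> {subset t <= star} ->
  phi x v ([set y in t] :|: L) =
  (v \in t)%:R * (3 * petP x - dualA x * (n 2)%:R - dualB x * (n 3)%:R)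
  + dualA x * (2 * (count (adj v) t == 2))%:R
  + dualB x * (3 * (count (adj v) t == 3))%:R - 3 * petN x.
Proof.
move=> ut ts; rewrite /phi !inE (negPf vL) orbF (degU_seq v ut ts) nvL cards0.
have degsE k : nbrs_of_deg ([set y in t] :|: L) v k = n k.
  rewrite /nbrs_of_deg /n /d /c -!(degU_seq _ ut ts).
  transitivity
    (count (fun u => occ_deg ([set y in t] :|: L) u == k) [:: u1; u2; u3]).
    rewrite -size_filter -(card_uniqP (filter_uniq _ u_uniq)).
    by apply: eq_card => y; rewrite inE mem_filter adj_u andbC inE.
  by rewrite /= addn0 addnA.
by rewrite !degsE addn0.
Qed.

Let adjE : (((adj v v = false) * (adj v u1 = true) * (adj v u2 = true)
  * (adj v u3 = true)) * ((adj u1 v = true) * (adj u2 v = true)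
  * (adj u3 v = true)) * ((adj u1 u1 = false) * (adj u2 u2 = false)
  * (adj u3 u3 = false)) * ((adj u1 u2 = false) * (adj u1 u3 = false)
  * (adj u2 u3 = false)) * ((adj u2 u1 = false) * (adj u3 u1 = false)
  * (adj u3 u2 = false)))%type.
Proof.
have := star_adj => /= -[a1 a2 a3 b1 b2 c1].
rewrite !adj_irrefl ![adj _ v]adj_sym ![adj u3 _]adj_sym ![adj u2 u1]adj_sym.
by rewrite a1 a2 a3 b1 b2 c1.
Qed.

(** The admissible [K] are [{v}] and the sets of those [u_i] that have no neighbour in [L]. *)
Lemma sum_star :
  \sum_(K : {set G} | (K \subset [set y in star]) && independent (K :|: L))
    x ^+ #|K| * phi x v (K :|: L) =
  evalz x (on_branches u1 u2 u3 L star_weight).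
Proof.
transitivity (\sum_(b <- indep_masks (rows star))
   if all (fun y => #|nbrs y :&: L| == 0)%N (mask b star) then
     x ^+ count id b * phi x v ([set y in mask b star] :|: L) else 0).
  transitivity (\sum_(K : {set G} | (K \subset [set y in star])
      && independent K)
     if [forall y in K, nbrs y :&: L == set0] then
       x ^+ #|K| * phi x v (K :|: L) else 0).
    rewrite -big_mkcondr; apply: eq_bigl => K.
    by rewrite independentU indL -andbA.
  rewrite sum_indep_seq // big_seq [RHS]big_seq; apply: eq_bigr => b bi.
  rewrite (_ : [forall y in _, _] =
    all (fun y => #|nbrs y :&: L| == 0%N) (mask b star)).
    case: ifP => // _; rewrite -(size_mask (size_indep_masks bi)).
    rewrite -(card_uniqP (mask_uniq star_uniq b)).
    by congr (_ ^+ _ * _); apply: eq_card => y; rewrite inE.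
  apply/forall_inP/allP => h y; first by move=> yb; rewrite cards_eq0 h ?inE.
  by rewrite inE -cards_eq0; exact: h.
have vu : (v \in [:: u1; u2; u3]) = false by rewrite adj_u adj_irrefl.
have {vu} [vu1 vu2 vu3] :
    [/\ v == u1 = false, v == u2 = false & v == u3 = false].
  by move: vu; rewrite !inE => /norP[/negPf-> /norP[/negPf-> /negPf->]].
under eq_bigr => b _ do
  rewrite (phi_seq (mask_uniq star_uniq b) (fun y => @mem_mask _ y b star)).
rewrite star_adj /star !big_cons big_nil /= !inE !adjE vu1 vu2 vu3 eqxx.
rewrite nvL cards0 /on_branches /=.
have := cover_le2 (_ : adj v u1); have := cover_le2 (_ : adj v u2).
have := cover_le2 (_ : adj v u3); rewrite !adjE.
move: #|nbrs u1 :&: L| #|nbrs u2 :&: L| #|nbrs u3 :&: L| => c1 c2 c3.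
move=> /(_ isT) h3 /(_ isT) h2 /(_ isT) h1.
rewrite /petP /petN /dualA /dualB.
(* Each count is at most 2, so 27 polynomial identities remain, which verify the table
   [star_weight]. *)
case: c1 h1 => [|[|[|//]]] _; case: c2 h2 => [|[|[|//]]] _;
  case: c3 h3 => [|[|[|//]]] _ /=.
all: rewrite /star_weight /= /Pos.to_nat /= ?(addn0,add0n,addn1,muln0,muln1) /=.
all: ring.
Qed.

End Inner.

(** * Reduction of the sum at a vertex to local configurations *)

Section VertexSum.
Variables (R : realFieldType) (x : R) (G : sgraph).
Hypothesis cub : cubic G.
Hypothesis tf : triangle_free G.
Variables v u1 u2 u3 : G.
Hypothesis nbrs_v : nbrs v = [set u1; u2; u3].
Hypothesis u_uniq : uniq [:: u1; u2; u3].
Implicit Types (J L S K I : {set G}).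

Definition star_set : {set G} := v |: nbrs v.
Definition second : {set G} :=
  [set w | (w \notin star_set) && [exists u in nbrs v, adj u w]].
Definition unblocked J : {set G} := [set w in second | nbrs w :&: J == set0].

Definition mask_code_ge : rel G :=
  fun y z => (mask_code (branch_mask u1 u2 u3 z)
                <= mask_code (branch_mask u1 u2 u3 y))%N.
Definition local_config J : seq cell :=
  config u1 u2 u3 (sort mask_code_ge (enum (unblocked J))).

Lemma mem_local J y :
  (y \in sort mask_code_ge (enum (unblocked J))) = (y \in unblocked J).
Proof. by rewrite mem_sort mem_enum. Qed.

Lemma local_uniq J : uniq (sort mask_code_ge (enum (unblocked J))).
Proof. by rewrite sort_uniq enum_uniq. Qed.

Lemma valid_local_config J : valid_config (local_config J).
Proof.
apply: (valid_config_of_graph tf nbrs_v cub (local_uniq J)).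
- by rewrite mem_local !inE eqxx.
- move=> y; rewrite mem_local !inE => /andP[/andP[_ /exists_inP[u]]] + + _.
  by rewrite nbrs_v !inE -orbA => /or3P[]/eqP-> ->; rewrite ?orbT.
- by apply: sort_sorted => y z; exact: leq_total.
Qed.

Lemma disjoint_star L : L \subset ~: star_set -> [disjoint L & star_set].
Proof. by rewrite -disjoints_subset. Qed.

Lemma sum_over_star L : L \subset ~: star_set -> independent L ->
  \sum_(K : {set G} | (K \subset star_set) && independent (L :|: K))
    x ^+ #|L :|: K| * phi x v (L :|: K) =
  x ^+ #|L| * evalz x (on_branches u1 u2 u3 L star_weight).
Proof.
move=> sL iL; have dL := disjoint_star sL.
have vL : v \notin L.
  by apply: contraL sL => vL; apply/subsetPn; exists v; rewrite ?inE ?eqxx.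
have nvL : nbrs v :&: L = set0.
  apply: disjoint_setI0; rewrite disjoint_sym.
  by apply: disjointWr dL; exact: subsetUr.
rewrite -(sum_star x tf nbrs_v u_uniq vL nvL iL cub) big_distrr /=.
have -> : [set y in [:: v; u1; u2; u3]] = star_set.
  by apply/setP => y; rewrite /star_set nbrs_v !inE -!orbA.
apply: eq_big => K; first by rewrite setUC.
move=> /andP[sK _]; rewrite cardsU (_ : L :&: K = set0); last first.
  by apply: disjoint_setI0; apply: disjointWr dL.
by rewrite cards0 subn0 exprD mulrA setUC.
Qed.

(** An independent set is split as [J :|: S :|: K], with [K] in the star, [S] among the second
    neighbours and [J] farther away. Summing over [K] first leaves the star weight; independence
    from [J] then confines [S] to [unblocked J]. *)
Lemma sum_vertex :
  \sum_(I : {set G} | independent I) x ^+ #|I| * phi x v I =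
  \sum_(J : {set G} | (J \subset ~: (star_set :|: second)) && independent J)
    x ^+ #|J| * evalz x (config_weight (local_config J)).
Proof.
transitivity (\sum_(L : {set G} | (L \subset ~: star_set) && independent L)
    x ^+ #|L| * evalz x (on_branches u1 u2 u3 L star_weight)).
  rewrite big_mkcond.
  rewrite (eq_bigl
    (fun I : {set G} => I \subset ~: star_set :|: star_set)); last first.
    by move=> I; rewrite setUC setUCr subsetT.
  rewrite sum_subsets_split ?disjoints_subset // big_mkcondr.
  apply: eq_bigr => L sL; case: ifP => iL.
    by rewrite -sum_over_star // big_mkcondr.
  by rewrite big1 // => K _; rewrite independentU iL.
rewrite big_mkcondr.
have -> : ~: star_set = ~: (star_set :|: second) :|: second.
  apply/setP => y; rewrite in_setC [in RHS]in_setU in_setC in_setU.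
  have : y \in second -> y \notin star_set by rewrite inE => /andP[].
  by case: (y \in second) => [/(_ isT) ->|_]; rewrite ?orbT ?orbF.
rewrite sum_subsets_split; last first.
  by rewrite disjoints_subset setCS subsetUr.
rewrite [RHS]big_mkcondr; apply: eq_bigr => J sJ; case: ifP => iJ; last first.
  by rewrite big1 // => S _; rewrite independentU iJ.
(* A neighbour of [u] lies in the star or in [second], both avoided by [J]; the star weight of
   [J :|: S] therefore depends on [S] alone. *)
have cJ u : u \in nbrs v -> nbrs u :&: J = set0.
  move=> uv; apply/setP => y; rewrite [RHS]inE; apply/negP.
  rewrite inE => /andP[uy yJ].
  have := subsetP sJ _ yJ; rewrite inE => /negP; apply.
  rewrite inE orbC; case: (boolP (y \in star_set)); rewrite ?orbT // => yst.
  rewrite inE yst; apply/orP; left; apply/exists_inP; exists u => //.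
  by move: uy; rewrite inE.
rewrite /local_config -config_weightE ?local_uniq // big_distrr /= -big_mkcondr.
have -> : [set y in sort mask_code_ge (enum (unblocked J))] = unblocked J.
  by apply/setP => y; rewrite inE mem_local.
apply: eq_big => [S|S /andP[sS _]].
  rewrite independentU iJ /=.
  apply/andP/andP => [[sS /andP[iS /forall_inP h]]|[/subsetP sS iS]].
    split=> //; apply/subsetP => y yS.
    rewrite [_ \in unblocked J]inE (subsetP sS) //=.
    apply/eqP/setP => z; rewrite !inE; apply/negP => /andP[yz zJ].
    have /eqP/setP/(_ y) := h z zJ.
    by rewrite !inE yS adj_sym yz.
  split.
    by apply/subsetP => y /sS; rewrite [_ \in unblocked J]inE => /andP[].
  rewrite iS; apply/forall_inP => z zJ; apply/eqP/setP => y; rewrite !inE.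
  apply/negP => /andP[zy /sS].
  rewrite [_ \in unblocked J]inE => /andP[_ /eqP/setP/(_ z)].
  by rewrite !inE zJ adj_sym zy.
have JS : J :&: S = set0.
  apply: disjoint_setI0; apply: disjointWl sJ _; rewrite disjoint_sym.
  by rewrite disjoints_subset setCK (subset_trans sS) ?subsetUr.
rewrite cardsU JS cards0 subn0 exprD -mulrA; congr (_ * (_ * evalz x _)).
by rewrite /on_branches !setIUr !cJ ?set0U // nbrs_v !inE eqxx ?orbT.
Qed.

End VertexSum.

(** * The occupancy inequality *)

Section IndepPoly.
Variables (R : realFieldType) (G : sgraph).

Lemma horner_indep_poly (x : R) :
  (indep_poly R G).[x] = \sum_(I : {set G} | independent I) x ^+ #|I|.
Proof.
rewrite /indep_poly horner_sum; under eq_bigr do rewrite hornerXn.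
by apply: eq_bigl => I; rewrite inE.
Qed.

Lemma horner_deriv_indep_poly (x : R) :
  x * (indep_poly R G)^`().[x] =
  \sum_(I : {set G} | independent I) x ^+ #|I| * #|I|%:R.
Proof.
rewrite /indep_poly raddf_sum horner_sum mulr_sumr.
apply: eq_big => [I|I _]; first by rewrite inE.
rewrite /= derivXn hornerMn hornerXn; case: #|I| => [|n] /=.
  by rewrite mulr0n !mulr0.
by rewrite -mulr_natr mulrA exprS.
Qed.

Lemma indep_poly1 : (indep_poly R G).[1] = #|indep_sets G|%:R.
Proof.
rewrite horner_indep_poly -sum1_card natr_sum.
by apply: eq_big => [I|I _]; rewrite ?inE ?expr1n.
Qed.

Lemma indep_poly_gt0 (x : R) : 0 <= x -> 0 < (indep_poly R G).[x].
Proof.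
move=> x0; rewrite horner_indep_poly (bigD1 set0) /=; last first.
  by apply/forall_inP => y; rewrite inE.
rewrite cards0 expr0 ltr_wpDr // sumr_ge0 // => I _; exact: exprn_ge0.
Qed.

Lemma indep_poly0 : (indep_poly R G).[0] = 1.
Proof.
rewrite horner_indep_poly (bigD1 set0) /=; last first.
  by apply/forall_inP => y; rewrite inE.
rewrite cards0 expr0 big1 ?addr0 // => I /andP[_]; rewrite -card_gt0 => I0.
by rewrite expr0n eqn0Ngt I0.
Qed.

End IndepPoly.

Section Occupancy.
Variables (R : realFieldType) (G : sgraph).
Hypothesis cub : cubic G.
Hypothesis tf : triangle_free G.

Lemma nbrs3 (v : G) :
  exists u1 u2 u3, nbrs v = [set u1; u2; u3] /\ uniq [:: u1; u2; u3].
Proof.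
have := cub v; rewrite -[[set y | _]]/(nbrs v) cardE.
case E: (enum (nbrs v)) => [|u1 [|u2 [|u3 [|? ?]]]] // _.
exists u1, u2, u3; rewrite -E enum_uniq; split=> //.
by apply/setP => y; rewrite -mem_enum E !inE -orbA.
Qed.

Lemma config_weight_ge0 (x : R) c : 0 <= x <= 1 -> valid_config c ->
  0 <= evalz x (config_weight c).
Proof. by move=> x01 /valid_config_ok/andP[/psums_ge0_eval->]. Qed.

Lemma sum_vertex_ge0 (x : R) (v : G) : 0 <= x <= 1 ->
  0 <= \sum_(I : {set G} | independent I) x ^+ #|I| * phi x v I.
Proof.
move=> x01; have [u1 [u2 [u3 [nbrs_v uu]]]] := nbrs3 v.
rewrite (sum_vertex x cub tf nbrs_v uu) sumr_ge0 // => J _.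
rewrite mulr_ge0 ?config_weight_ge0 ?(valid_local_config cub tf nbrs_v) //.
by rewrite exprn_ge0 //; case/andP: x01.
Qed.

(** The term of the empty [J], which blocks no second neighbour, is already positive, and all others
    are nonnegative. *)
Lemma sum_vertex_gt0 (x : R) (v u1 u2 u3 : G) : 0 < x < 1 ->
  nbrs v = [set u1; u2; u3] -> uniq [:: u1; u2; u3] ->
  local_config v u1 u2 u3 set0 \notin hexagons ->
  0 < \sum_(I : {set G} | independent I) x ^+ #|I| * phi x v I.
Proof.
move=> x01 nbrs_v uu nh; have x01' : 0 <= x <= 1.
  by case/andP: x01 => ? ?; rewrite !ltW.
rewrite (sum_vertex x cub tf nbrs_v uu) (bigD1 set0) /=; last first.
  by rewrite sub0set; apply/forall_inP => y; rewrite inE.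
rewrite cards0 expr0 mul1r ltr_pwDl //; last first.
  apply: sumr_ge0 => J _.
  rewrite mulr_ge0 ?config_weight_ge0 ?(valid_local_config cub tf nbrs_v) //.
  by rewrite exprn_ge0 //; case/andP: x01'.
have /valid_config_ok/andP[ge0] := valid_local_config cub tf nbrs_v set0.
by case: ifP => [_|/negbT nz _]; [rewrite (negPf nh)|exact: psums_gt0].
Qed.

Lemma sum_phi_poly (x : R) :
  \sum_v \sum_(I : {set G} | independent I) x ^+ #|I| * phi x v I =
  3 * (petP x * (x * (indep_poly R G)^`().[x])
       - petN x * #|G|%:R * (indep_poly R G).[x]).
Proof.
rewrite exchange_big /= horner_deriv_indep_poly horner_indep_poly.
rewrite !mulr_sumr -sumrB mulr_sumr; apply: eq_bigr => I _.
rewrite -mulr_sumr sum_phi; ring.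
Qed.

Lemma occupancy_ge (x : R) : 0 <= x <= 1 ->
  petN x * #|G|%:R * (indep_poly R G).[x] <=
  petP x * (x * (indep_poly R G)^`().[x]).
Proof.
move=> x01; rewrite -subr_ge0 -(pmulr_rge0 _ (ltr0Sn R 2)) -sum_phi_poly.
by apply: sumr_ge0 => v _; exact: sum_vertex_ge0.
Qed.

Lemma occupancy_gt (x : R) (v u1 u2 u3 : G) : 0 < x < 1 ->
  nbrs v = [set u1; u2; u3] -> uniq [:: u1; u2; u3] ->
  local_config v u1 u2 u3 set0 \notin hexagons ->
  petN x * #|G|%:R * (indep_poly R G).[x] <
  petP x * (x * (indep_poly R G)^`().[x]).
Proof.
move=> x01 nbrs_v uu nh.
rewrite -subr_gt0 -(pmulr_rgt0 _ (ltr0Sn R 2)) -sum_phi_poly.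
rewrite (bigD1 v) //= ltr_pwDl ?(sum_vertex_gt0 _ nbrs_v uu nh) //.
apply: sumr_ge0 => w _; apply: sum_vertex_ge0.
by case/andP: x01 => ? ?; rewrite !ltW.
Qed.

End Occupancy.

(** * The Petersen graph and its independence polynomial *)

Definition pvertices : seq petersen :=
  [:: (false, Ordinal (isT : 0 < 5)%N); (false, Ordinal (isT : 1 < 5)%N);
      (false, Ordinal (isT : 2 < 5)%N); (false, Ordinal (isT : 3 < 5)%N);
      (false, Ordinal (isT : 4 < 5)%N); (true, Ordinal (isT : 0 < 5)%N);
      (true, Ordinal (isT : 1 < 5)%N); (true, Ordinal (isT : 2 < 5)%N);
      (true, Ordinal (isT : 3 < 5)%N); (true, Ordinal (isT : 4 < 5)%N)].

Lemma mem_pvertices (p : petersen) : p \in pvertices.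
Proof. by case: p => [[] [[|[|[|[|[|//]]]]] i]]. Qed.

Lemma pvertices_uniq : uniq pvertices.
Proof. by []. Qed.

Lemma card_petersen : #|petersen| = 10%N.
Proof.
rewrite -(card_uniqP pvertices_uniq : _ = 10%N); apply: eq_card => p.
by rewrite mem_pvertices.
Qed.

(** Moves the sum to lists of integers, where the enumeration can be evaluated by computation. *)
Lemma sum_evalz (R : realFieldType) (x : R) (r : seq bitseq) :
  \sum_(b <- r) x ^+ count id b =
  evalz x (foldr addz [::] [seq shiftz (count id b) [:: Zpos xH] | b <- r]).
Proof.
elim: r => [|b r IH]; first by rewrite big_nil.
by rewrite big_cons /= evalz_add evalz_shift IH /= mulr0 addr0 mulr1.
Qed.

Lemma petersen_poly (R : realFieldType) (x : R) :
  (indep_poly R petersen).[x] = petP x.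
Proof.
rewrite horner_indep_poly.
transitivity (\sum_(b <- indep_masks (rows pvertices)) x ^+ count id b).
  rewrite (eq_bigl (fun S : {set petersen} =>
    (S \subset [set p in pvertices]) && independent S)); last first.
    move=> S; rewrite (_ : [set _ in _] = setT) ?subsetT //.
    by apply/setP => p; rewrite in_setT in_set mem_pvertices.
  rewrite (sum_indep_seq _ pvertices_uniq) big_seq [RHS]big_seq.
  apply: eq_bigr => b bi; rewrite -(size_mask (size_indep_masks bi)).
  rewrite -(card_uniqP (mask_uniq pvertices_uniq b)).
  by congr (_ ^+ _); apply: eq_card => y; rewrite inE.
rewrite sum_evalz.
set l := foldr _ _ _; have -> : l = [:: 1; 10; 30; 30; 5]%Zbin by vm_compute.
rewrite /petP /= /Pos.to_nat /=; ring.
Qed.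

(** An explicit polynomial, to be differentiated term by term. *)
Definition petersen_polynomial (R : realFieldType) : {poly R} :=
  1 + 10 *: 'X + 30 *: 'X^2 + 30 *: 'X^3 + 5 *: 'X^4.

Lemma horner_petersen_polynomial (R : realFieldType) (x : R) :
  (petersen_polynomial R).[x] = petP x.
Proof.
rewrite /petersen_polynomial -polyC1.
rewrite !(hornerD, hornerZ, hornerXn, hornerX, hornerC) /petP; ring.
Qed.

Lemma deriv_petersen_polynomial (R : realFieldType) (x : R) :
  x * (petersen_polynomial R)^`().[x] = 10 * petN x.
Proof.
rewrite /petersen_polynomial !derivD !derivZ !derivXn derivX -polyC1 derivC.
rewrite !(hornerD, hornerZ, hornerXn, hornerX, hornerC, hornerMn) /petN.
ring.
Qed.

(** * The case of equality *)

Local Close Scope ring_scope.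

(** [rows] records only the part above the diagonal; symmetry and irreflexivity recover the rest. *)
Lemma rows_adj (G H : sgraph) (v : G) (w : H) (s : seq G) (t : seq H) i j :
  size s = size t -> rows s = rows t -> i < size s -> j < size s ->
  adj (nth v s i) (nth v s j) = adj (nth w t i) (nth w t j).
Proof.
elim: s t i j => [|x s IH] [|y t] //= [|i] [|j] [st] [rxy rst].
- by rewrite !adj_irrefl.
- move=> _ js; have := congr1 (nth false ^~ j) rxy.
  by rewrite !(nth_map v, nth_map w) // -st.
- move=> js _; have := congr1 (nth false ^~ i) rxy.
  by rewrite !(nth_map v, nth_map w) -?st // adj_sym [in RHS]adj_sym.
- by move=> is_ js; exact: IH.
Qed.

(* Adjacencies once [u1], [u2], [u3] and [v] are appended to the list. *)
Definition full_row (e : cell) : bitseq :=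
  e.2 ++ [:: m1 e.1; m2 e.1; m3 e.1; false].

Definition full_rows (c : seq cell) : seq bitseq :=
  [seq full_row e | e <- c] ++
  [:: [:: false; false; true]; [:: false; true]; [:: true]; [::]].

(** The last four entries stand for [u1], [u2], [u3] and [v]. The bits [a] and [b] swap the two
    second neighbours behind [u2] and behind [u1], matching the labellings in [hexagons]. *)
Definition hexagon_vertices (a b : bool) : seq petersen :=
  let p := nth (false, ord0) pvertices in
  [:: p 7; p 8; p (if a then 9 else 3); p (if a then 3 else 9);
      p (if b then 2 else 6); p (if b then 6 else 2); p 1; p 4; p 5; p 0].

Lemma hexagon_petersen c : c \in hexagons ->
  exists t : seq petersen, [/\ uniq t, size t = 10 & rows t = full_rows c].
Proof.
rewrite !inE => /or4P[] /eqP->;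
  [exists (hexagon_vertices false false)|exists (hexagon_vertices false true)
  |exists (hexagon_vertices true false)|exists (hexagon_vertices true true)];
  by split; vm_compute.
Qed.

Lemma cubic_petersen : cubic petersen.
Proof.
move=> p; transitivity (count (adj p) pvertices).
  rewrite -size_filter -(card_uniqP (filter_uniq _ pvertices_uniq)).
  by apply: eq_card => q; rewrite inE mem_filter mem_pvertices andbT.
by case: p => [[] [[|[|[|[|[|//]]]]] i]].
Qed.

Section HexagonComponent.
Variable G : sgraph.
Hypothesis cub : cubic G.
Hypothesis tf : triangle_free G.
Variables v u1 u2 u3 : G.
Hypothesis nbrs_v : nbrs v = [set u1; u2; u3].
Hypothesis u_uniq : uniq [:: u1; u2; u3].
Hypothesis hex : local_config v u1 u2 u3 set0 \in hexagons.

Let s := sort (mask_code_ge u1 u2 u3) (enum (unblocked v set0)).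
Let B := s ++ [:: u1; u2; u3; v].

Let mem_s x : x \in s = (x \in second v).
Proof. by rewrite mem_local /unblocked inE setI0 eqxx andbT. Qed.

Let vu i : i \in [:: u1; u2; u3] = adj v i.
Proof. by have /setP/(_ i) := nbrs_v; rewrite !inE -orbA. Qed.

Let s_not_adj x : x \in s -> x != v /\ adj v x = false.
Proof. by rewrite mem_s !inE => /andP[/norP[-> /negPf->]]. Qed.

Let B_uniq : uniq B.
Proof.
rewrite cat_uniq local_uniq andTb; apply/andP; split.
  apply/hasPn => x; rewrite -[[:: u1, u2, u3 & _]]/([:: u1; u2; u3] ++ [:: v]).
  rewrite mem_cat vu inE => xv; apply/negP => /s_not_adj[/negPf xnv xn].
  by move: xv; rewrite xnv xn.
have : v \notin [:: u1; u2; u3] by rewrite vu adj_irrefl.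
move: u_uniq => /= h; move: h; rewrite !inE !negb_or ![_ == v]eq_sym.
by move=> /and3P[/andP[-> ->] -> _] /and3P[-> -> ->].
Qed.

Let rows_B : rows B = full_rows (config u1 u2 u3 s).
Proof.
rewrite /B /full_rows; have : {in s, forall x, adj v x = false}.
  by move=> x /s_not_adj[].
elim: s => [|x r IH] hs /=.
  have au u : u \in [:: u1; u2; u3] -> adj v u by rewrite vu.
  have nuu u u' : u \in [:: u1; u2; u3] -> u' \in [:: u1; u2; u3] ->
      adj u u' = false.
    by move=> /au vu' /au vu''; apply/negP => uu'; exact: tf vu' uu' vu''.
  by rewrite ![adj _ v]adj_sym !au ?nuu ?inE ?eqxx ?orbT.
rewrite IH; last by move=> y yr; apply: hs; rewrite inE yr orbT.
congr (_ :: _); rewrite /full_row /= map_cat /= ![adj x _]adj_sym.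
by rewrite hs ?mem_head.
Qed.

(** The ten vertices of [B] have the same adjacency rows as a listing [t] of the Petersen graph.
    Since both graphs are cubic, no edge leaves [B], so [B] is the component of [v]. *)
Lemma hexagon_component :
  isomorphic (induced [set y | connect (@adj G) v y]) petersen.
Proof.
have [t [t_uniq size_t rows_t]] := hexagon_petersen hex.
(* Ten distinct entries exhaust the ten vertices. *)
have t_all p : p \in t.
  have := uniq_min_size t_uniq (fun q _ => mem_pvertices q).
  by rewrite size_t => /(_ isT)[_ ->]; exact: mem_pvertices.
have size_rows (H : sgraph) (r : seq H) : size (rows r) = size r.
  by elim: r => //= y r ->.
have rBt : rows B = rows t by rewrite rows_t rows_B.
have size_B : size B = size t by rewrite -!size_rows rBt.
pose g p : G := nth v B (index p t).
have adj_g p q : adj (g p) (g q) = adj p q.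
  rewrite /g (rows_adj _ p size_B rBt) ?size_B ?index_mem ?t_all //.
  by rewrite !nth_index.
have g_inj : injective g.
  move=> p q /eqP; rewrite /g nth_uniq ?size_B ?index_mem ?t_all //.
  by move=> /eqP/(congr1 (nth p t)); rewrite !nth_index.
pose f y : petersen := nth (false, ord0) t (index y B).
have fK y : y \in B -> g (f y) = y.
  by move=> yB; rewrite /g index_uniq ?nth_index // -size_B index_mem.
have gB p : g p \in B by rewrite mem_nth // size_B index_mem.
have gK p : f (g p) = p.
  by rewrite /f index_uniq ?nth_index // size_B index_mem.
(* The image consists of three neighbours of [g p], and there are no more than three. *)
have nb_g p : nbrs (g p) = g @: nbrs p.
  apply/esym/eqP; rewrite eqEcard card_imset // cub cubic_petersen leqnn andbT.
  by apply/subsetP => y /imsetP[q]; rewrite !inE => pq ->; rewrite adj_g.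
have B_closed : closed (@adj G) (mem B).
  apply: intro_closed; first exact: sym_connect_sym (@adj_sym G).
  move=> y z yz /fK yB; have : z \in nbrs (g (f y)) by rewrite yB inE.
  by rewrite nb_g => /imsetP[q _ ->]; exact: gB.
have C_B y : connect (@adj G) v y = (y \in B).
  apply/idP/idP => [vy|].
    have <- : (v \in B) = (y \in B).
      by exact: (@closed_connect _ _ (mem B) B_closed).
    by rewrite mem_cat !inE eqxx !orbT.
  rewrite /B mem_cat mem_s => /orP[|].
    rewrite !inE => /andP[_ /exists_inP[u]]; rewrite inE => vu' uy.
    exact: connect_trans (connect1 vu') (connect1 uy).
  rewrite -[[:: u1, u2, u3 & _]]/([:: u1; u2; u3] ++ [:: v]) mem_cat vu inE.
  by case/orP => [/connect1//|/eqP->]; exact: connect0.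
have valB (y : induced [set y | connect (@adj G) v y]) : val y \in B.
  by rewrite -C_B; have := valP y; rewrite inE.
have gC p : g p \in [set y | connect (@adj G) v y] by rewrite inE C_B.
exists (fun y => f (val y)).
  exists (fun p => Sub (g p) (gC p)) => [y|p]; last by rewrite /= gK.
  by apply: val_inj; rewrite /= (fK _ (valB y)).
by move=> y z; rewrite -adj_g (fK _ (valB y)) (fK _ (valB z)).
Qed.

End HexagonComponent.

Local Open Scope ring_scope.

(** * Multiplicativity of the independence polynomial over components *)

Section Product.
Variables (R : realFieldType) (x : R) (G : sgraph).
Implicit Types (A B C : {set G}).

Definition indep_sum A : R :=
  \sum_(I : {set G} | (I \subset A) && independent I) x ^+ #|I|.

Lemma indep_sumU A B : [disjoint A & B] ->
  {in A & B, forall y z, ~~ adj y z} ->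
  indep_sum (A :|: B) = indep_sum A * indep_sum B.
Proof.
move=> dAB nAB; rewrite /indep_sum big_mkcondr sum_subsets_split //.
rewrite mulr_suml [RHS]big_mkcondr /=; apply: eq_bigr => S sS.
rewrite big_mkcond; case: ifP => iS; last first.
  rewrite big1 // => S' _; rewrite independentU iS /=; by case: ifP.
rewrite mulr_sumr [RHS]big_mkcond /=; apply: eq_bigr => S' _.
case: (boolP (S' \subset B)) => //= sS'; rewrite independentU iS /=.
rewrite (_ : [forall y in S, _] = true) ?andbT; last first.
  apply/forall_inP => y yS; apply/eqP/setP => z; rewrite !inE.
  apply/negP => /andP[yz zS'].
  by have := nAB y z (subsetP sS _ yS) (subsetP sS' _ zS'); rewrite yz.
case: ifP => // _.
rewrite cardsU (_ : S :&: S' = set0) ?cards0 ?subn0 ?exprD //.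
by apply: disjoint_setI0; apply: disjointW dAB.
Qed.

Lemma indep_sum0 : indep_sum set0 = 1.
Proof.
rewrite /indep_sum (bigD1 set0) /=; last first.
  by rewrite sub0set; apply/forall_inP => y; rewrite inE.
rewrite cards0 expr0 big1 ?addr0 // => I /andP[/andP[]].
by rewrite subset0 => ->.
Qed.

Lemma component_eq C y : C \in components G -> y \in C ->
  C = [set z | connect (@adj G) y z].
Proof.
move=> /imsetP[w _ ->]; rewrite inE => wy; apply/setP => z; rewrite !inE.
by rewrite (same_connect (sym_connect_sym (@adj_sym G)) wy).
Qed.

Lemma components_separated C C' y z : C \in components G ->
  C' \in components G -> y \in C -> z \in C' -> connect (@adj G) y z -> C = C'.
Proof.
move=> hC hC' yC zC' yz; rewrite (component_eq hC yC) (component_eq hC' zC').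
apply/setP => w; rewrite !inE.
by rewrite (same_connect (sym_connect_sym (@adj_sym G)) yz).
Qed.

Lemma indep_sum_components (r : seq {set G}) : uniq r ->
  {subset r <= components G} ->
  indep_sum (\bigcup_(C <- r) C) = \prod_(C <- r) indep_sum C /\
  #|\bigcup_(C <- r) C| = (\sum_(C <- r) #|C|)%N.
Proof.
elim: r => [|C r IH] /=; first by rewrite !big_nil indep_sum0 cards0.
move=> /andP[Cr ur] rs; rewrite !big_cons.
have [|<- <-] := IH ur; first by move=> C' h; apply: rs; rewrite inE h orbT.
have sep y z : y \in C -> z \in \bigcup_(C' <- r) C' -> ~~ connect (@adj G) y z.
  move=> yC zU; apply/negP => yz.
  have [C' C'r zC'] : exists2 C', C' \in r & z \in C'.
    elim: r zU {IH Cr ur rs} => [|C' r IH]; first by rewrite big_nil inE.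
    rewrite big_cons inE => /orP[zC'|/IH[C'' h1 h2]].
      by exists C'; rewrite ?mem_head.
    by exists C''; rewrite // inE h1 orbT.
  have eC : C = C'.
    by apply: (components_separated _ _ yC zC' yz); apply: rs;
      rewrite inE ?eqxx ?C'r ?orbT.
  by move: Cr; rewrite eC C'r.
have dC : [disjoint C & \bigcup_(C' <- r) C'].
  apply/pred0P => y /=; apply/negP => /andP[yC /(sep _ _ yC)].
  by rewrite connect0.
split; last by rewrite cardsU disjoint_setI0 // cards0 subn0.
apply: indep_sumU => // y z yC zU.
apply: contra (sep _ _ yC zU); exact: connect1.
Qed.

Lemma cover_components : \bigcup_(C <- enum (components G)) C = setT.
Proof.
apply/setP => y; rewrite inE; rewrite big_enum.
apply/bigcupP; exists [set z | connect (@adj G) y z].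
  by apply/imsetP; exists y.
by rewrite inE connect0.
Qed.

(** The inverse isomorphism followed by the inclusion of [C] embeds [H] in [G]; images and preimages
    under it match the independent sets. *)
Lemma induced_iso (H : sgraph) C : isomorphic (induced C) H ->
  indep_sum C = (indep_poly R H).[x] /\ #|C| = #|H|.
Proof.
case=> f [g fK gK] adj_f; pose h p : G := val (g p).
have h_inj : injective h by move=> p q /val_inj/(can_inj gK).
have adj_h p q : adj (h p) (h q) = adj p q.
  by rewrite -{2}[p]gK -{2}[q]gK adj_f.
have hC p : h p \in C by exact: valP (g p).
have Ch y : y \in C -> exists p, y = h p.
  by move=> yC; exists (f (Sub y yC)); rewrite /h fK.
split; last first.
  rewrite -cardsT -(card_imset _ h_inj); apply: eq_card => y; apply/idP/imsetP.
    by move=> /Ch[p ->]; exists p.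
  by case=> p _ ->.
rewrite horner_indep_poly /indep_sum.
rewrite (reindex_onto (fun S : {set H} => h @: S) (fun I => h @^-1: I)) /=.
  apply: eq_big => [S|S _]; last by rewrite card_imset.
  have -> : h @: S \subset C by apply/subsetP => y /imsetP[p _ ->].
  have -> : h @^-1: (h @: S) == S.
    by apply/eqP/setP => p; rewrite inE mem_imset.
  rewrite andbT; apply/independentP/independentP => hS.
    by move=> p q pS qS; rewrite -adj_h hS // imset_f.
  by move=> _ _ /imsetP[p pS ->] /imsetP[q qS ->]; rewrite adj_h hS.
move=> I /andP[/subsetP sI _]; apply/setP => y; apply/imsetP/idP.
  by case=> p; rewrite inE => hp ->.
by move=> yI; have [p yp] := Ch _ (sI _ yI); exists p; rewrite // inE -yp.
Qed.

Lemma union_of_copies_poly (H : sgraph) : union_of_copies H G ->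
  (indep_poly R G).[x] = (indep_poly R H).[x] ^+ #|components G| /\
  #|G| = (#|components G| * #|H|)%N.
Proof.
move=> uc; have [] := @indep_sum_components (enum (components G)).
- exact: enum_uniq.
- by move=> C; rewrite mem_enum.
rewrite cover_components cardsT => eP eN; split; last first.
  rewrite eN big_enum -sum_nat_const; apply: eq_bigr => C hC.
  by have [_] := induced_iso (uc C hC).
rewrite horner_indep_poly -[RHS]prodr_const.
transitivity (indep_sum setT).
  by apply: eq_bigl => I; rewrite subsetT.
rewrite eP big_enum /=; apply: eq_bigr => C hC.
by have [-> _] := induced_iso (uc C hC).
Qed.

End Product.

(** * Integration *)

From mathcomp Require Import all_classical all_reals all_analysis.

Local Open Scope ring_scope.

Section Log.
Variable R : realType.

Lemma is_derive_ln_horner (p : {poly R}) (y : R) : 0 < p.[y] ->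
  is_derive y 1 (fun z => ln p.[z]) (p^`().[y] / p.[y]).
Proof.
move=> py; have := is_derive1_comp (is_derive1_ln py) (is_derive_poly p y).
by rewrite mulrC.
Qed.

(** The mean value theorem does the work of integration: the function vanishes at 0, so its value at
    [b] is [b] times its derivative at an interior point. *)
Lemma log_ratio_MVT (p q : {poly R}) (k n b : R) : 0 < b ->
  (forall y, 0 <= y <= b -> 0 < p.[y] /\ 0 < q.[y]) ->
  p.[0] = 1 -> q.[0] = 1 ->
  exists2 c, 0 < c < b & k * ln p.[b] - n * ln q.[b] =
    (k * (p^`().[c] / p.[c]) - n * (q^`().[c] / q.[c])) * b.
Proof.
move=> b0 pos p0 q0.
pose f y := k * ln p.[y] - n * ln q.[y].
pose df y := k * (p^`().[y] / p.[y]) - n * (q^`().[y] / q.[y]).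
have dff y : 0 <= y <= b -> is_derive y 1 f (df y).
  move=> /pos[py qy].
  have dp := is_derive_ln_horner py; have dq := is_derive_ln_horner qy.
  exact: (is_deriveB (is_deriveZ k dp) (is_deriveZ n dq)).
have [y||c] := @MVT R f df 0 b b0.
- by rewrite in_itv /= => /andP[y0 yb]; apply: dff; rewrite !ltW.
- apply: derivable_within_continuous => y; rewrite in_itv /= => yb.
  by have [] := dff y yb.
rewrite in_itv /= => cb; rewrite subr0 /f p0 q0 ln1 !mulr0 subrr subr0 => ->.
by exists c.
Qed.

End Log.

Lemma petP_gt0 (R : realFieldType) (x : R) : 0 <= x -> 0 < petP x.
Proof. by move=> x0; rewrite -petersen_poly indep_poly_gt0. Qed.

Section Compare.
Variables (R : realType) (G : sgraph).
Hypothesis cub : cubic G.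
Hypothesis tf : triangle_free G.

(** Even for [x = 1] the point [c] is interior, so the strict form of the occupancy inequality is
    available there. *)
Lemma log_indep_poly_gap (x : R) : 0 < x <= 1 -> exists2 c : R, 0 < c < 1 &
  exists2 d, 0 < d & 10 * ln (indep_poly R G).[x] - #|G|%:R * ln (petP x) =
    d * (petP c * (c * (indep_poly R G)^`().[c])
         - petN c * #|G|%:R * (indep_poly R G).[c]).
Proof.
move=> /andP[x0 x1].
have [|||c cx] := @log_ratio_MVT R (indep_poly R G) (petersen_polynomial R)
  10 #|G|%:R x x0.
- move=> y /andP[y0 _]; rewrite horner_petersen_polynomial.
  by split; [exact: indep_poly_gt0|exact: petP_gt0].
- exact: indep_poly0.
- by rewrite horner_petersen_polynomial -petersen_poly indep_poly0.
rewrite !horner_petersen_polynomial => ->; case/andP: cx => c0 cx.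
exists c; first by rewrite c0 (lt_le_trans cx).
have Pc := petP_gt0 (ltW c0); have Gc := @indep_poly_gt0 R G c (ltW c0).
(* Obtained by putting both logarithmic derivatives at [c] over a common denominator, with [petN c]
   equal to [c / 10] times the derivative of the Petersen polynomial. *)
exists (10 * x / (c * petP c * (indep_poly R G).[c])).
  by rewrite !(mulr_gt0, invr_gt0).
have -> : petN c = c * (petersen_polynomial R)^`().[c] / 10.
  by rewrite deriv_petersen_polynomial; field.
field; by rewrite !gt_eqF.
Qed.

Lemma log_gap_ge0 (x : R) : 0 < x <= 1 ->
  0 <= 10 * ln (indep_poly R G).[x] - #|G|%:R * ln (petP x).
Proof.
move=> /log_indep_poly_gap[c /andP[c0 c1] [d d0 ->]].
rewrite mulr_ge0 ?(ltW d0) // subr_ge0 (occupancy_ge cub tf) //.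
by rewrite !ltW.
Qed.

(** A vertex whose second neighbours form no hexagon makes the gap positive, so equality turns the
    component of every vertex into a Petersen graph. Conversely, for [k] copies [P_G] is the [k]-th
    power of the Petersen polynomial and [#|G|] is [10 k]. *)
Lemma log_gap_eq0 (x : R) : 0 < x <= 1 ->
  10 * ln (indep_poly R G).[x] - #|G|%:R * ln (petP x) = 0 <->
  union_of_copies petersen G.
Proof.
move=> x01; split => [|uc].
  move=> gap0 C /imsetP[v _ ->].
  have [u1 [u2 [u3 [nbrs_v uu]]]] := nbrs3 cub v.
  case: (boolP (local_config v u1 u2 u3 finset.set0 \in hexagons))
    => [hex|nhex].
    by have := hexagon_component cub tf nbrs_v uu hex.
  have [c c01 [d d0 gapE]] := log_indep_poly_gap x01.
  have := occupancy_gt cub tf c01 nbrs_v uu nhex.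
  rewrite -subr_gt0 -(pmulr_rgt0 _ d0) -gapE gap0.
  by rewrite ltxx.
have [-> ->] := union_of_copies_poly x uc.
have P0 : 0 < petP x by apply: petP_gt0; case/andP: x01 => /ltW.
rewrite petersen_poly lnXn // card_petersen natrM -mulr_natl.
ring.
Qed.

End Compare.

Theorem corollary4 (R : realType) (G : sgraph) (G_nonempty : (0 < #|G|)%N)
    (G_cubic : cubic G) (G_triangle_free : triangle_free G) :
  (forall lam : R, 0 < lam <= 1 ->
     1 / #|G|%:R * ln (indep_poly R G).[lam]
       >= 1 / 10 * ln (indep_poly R petersen).[lam]
     /\ (1 / #|G|%:R * ln (indep_poly R G).[lam]
           = 1 / 10 * ln (indep_poly R petersen).[lam]
         <-> union_of_copies petersen G))
  /\
  (1 / #|G|%:R * ln (#|indep_sets G|%:R : R)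
     >= 1 / 10 * ln (#|indep_sets petersen|%:R : R)
   /\ (1 / #|G|%:R * ln (#|indep_sets G|%:R : R)
         = 1 / 10 * ln (#|indep_sets petersen|%:R : R)
       <-> union_of_copies petersen G)).
Proof.
have main (lam : R) : 0 < lam <= 1 ->
     1 / #|G|%:R * ln (indep_poly R G).[lam]
       >= 1 / 10 * ln (indep_poly R petersen).[lam]
     /\ (1 / #|G|%:R * ln (indep_poly R G).[lam]
           = 1 / 10 * ln (indep_poly R petersen).[lam]
         <-> union_of_copies petersen G).
  move=> lam01; rewrite petersen_poly.
  have n0 : 0 < #|G|%:R :> R by rewrite ltr0n.
  have gapE : 1 / #|G|%:R * ln (indep_poly R G).[lam] - 1 / 10 * ln (petP lam)
    = (10 * ln (indep_poly R G).[lam] - #|G|%:R * ln (petP lam))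
      / (10 * #|G|%:R).
    by field; rewrite gt_eqF.
  have d0 : 0 < 10 * #|G|%:R :> R by rewrite mulr_gt0.
  split.
    rewrite -subr_ge0 gapE; apply: divr_ge0; last exact: ltW.
    exact: log_gap_ge0.
  rewrite -(log_gap_eq0 G_cubic G_triangle_free lam01); split=> [e|e].
    move/eqP: gapE; rewrite e subrr eq_sym mulf_eq0 invr_eq0 (gt_eqF d0) orbF.
    by move/eqP.
  by apply/eqP; rewrite -subr_eq0 gapE e mul0r.
(* The number of independent sets is the value of the polynomial at 1. *)
split=> //; rewrite -!indep_poly1; apply: main.
by rewrite ltr01 lexx.
Qed.
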